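(* Let $X$ be a discrete metric space of bounded geometry. For every non-empty invariant open subset $U\subseteq\beta X$, the collections $\mathcal{R}_{\min}(U)$ and $\mathcal{R}_{\max}(U)$ are rank distributions on $X$, and $U_{\mathcal{R}_{\max}(U)}=U_{\mathcal{R}_{\min}(U)}=U$.
   Context: Bounded geometry: for every $r>0$, $\sup_{x\in X}\sharp B(x,r)<\infty$. A subset $E\subseteq X\times X$ is an entourage if $\sup_{(x,y)\in E}d(x,y)<\infty$. Put $E_r=\{(x,y): d(x,y)\le r\}$. Rank distributions: A rank function is a function $\alpha:X\times X\to\mathbb{Z}_{\ge0}$ whose support $\mathrm{supp}(\alpha)=\{(x,y):\alpha(x,y)\neq 0\}$ is an entourage. For an entourage $E$, $(E\cdot\alpha)(x,y)=\sum_{z}\chi_E(x,z)\alpha(z,y)$ and $(\alpha\cdot E)(x,y)=\sum_z\alpha(x,z)\chi_E(z,y)$; $\alpha^t(x,y)=\alpha(y,x)$; sums and the order $\le$ are pointwise. A rank distribution on $X$ is a collection $\mathcal{R}$ of rank functions such that: (i) if $\alpha,\beta\in\mathcal{R}$ and $E$ is an entourage then $\alpha+\beta,\alpha^t,E\cdot\alpha,\alpha\cdot E\in\mathcal{R}$; (ii) every rank function with finite support is in $\mathcal{R}$; (iii) if $\alpha$ is a rank function with $\alpha\le\beta$ for some $\beta\in\mathcal{R}$ then $\alpha\in\mathcal{R}$. Invariant subsets: $\beta X$ is the Stone–Čech compactification of the discrete set $X$. The coarse groupoid is $G(X)=\bigcup_{r\ge0}\overline{E_r}^{\beta(X\times X)}\subseteq\beta(X\times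 X)$; the maps $r(x,y)=x$, $s(x,y)=y$ on $X\times X$ extend continuously to $r,s:G(X)\to\beta X$. The map $(r,s):G(X)\to\beta X\times\beta X$ is injective, and $G(X)$ carries the groupoid structure induced from the pair groupoid. $U\subseteq\beta X$ is invariant if every $\gamma\in G(X)$ with $s(\gamma)\in U$ also has $r(\gamma)\in U$. For a rank distribution $\mathcal{R}$, $U_{\mathcal{R}}:=\bigcup_{\alpha\in\mathcal{R}}\overline{r(\mathrm{supp}(\alpha))}$ (closures in $\beta X$). For a non-empty invariant open $U\subseteq\beta X$, $\mathcal{R}_{\max}(U)$ is the set of all rank functions $\alpha$ with $\overline{r(\mathrm{supp}(\alpha))}\subseteq U$, and $\mathcal{R}_{\min}(U)$ is the set of all bounded such rank functions. *)

(* Defs.v *)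
From HB Require Import structures.
From mathcomp Require Import all_boot all_order all_algebra.
From mathcomp Require Import all_classical all_reals topology.

Set Implicit Arguments.
Unset Strict Implicit.
Unset Printing Implicit Defensive.

Import Order.TTheory GRing.Theory Num.Theory.

Local Open Scope classical_set_scope.
Local Open Scope ring_scope.

(** * The Stone-Cech compactification of a discrete set

    It is realised as the space of ultrafilters on [T], the basic open sets
    being [[set w | w A]] for [A : set T].  The lemmas below establish the
    characterization: a compact Hausdorff space containing [T] as a dense
    subset, such that every map from [T] to a compact Hausdorff space has a
    unique continuous extension. *)

Record beta (T : Type) := Beta {
  beta_sets :> set_system T ;
  beta_ultra : UltraFilter beta_sets }.

#[global] Existing Instance beta_ultra.

HB.instance Definition _ (T : Type) := gen_eqMixin (beta T).
HB.instance Definition _ (T : Type) := gen_choiceMixin (beta T).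

Definition beta_basic (T : Type) (A : set T) : set (beta T) :=
  [set w | beta_sets w A].

Lemma beta_cover (T : Type) : \bigcup_(A in [set: set T]) beta_basic A = setT.
Proof. by apply/seteqP; split=> // w _; exists setT => //; exact: filterT. Qed.

Lemma beta_join (T : Type) (A B : set T) (w : beta T) :
  [set: set T] A -> [set: set T] B -> beta_basic A w -> beta_basic B w ->
  exists C, [/\ [set: set T] C, beta_basic C w &
                beta_basic C `<=` beta_basic A `&` beta_basic B].
Proof.
move=> _ _ wA wB; exists (A `&` B); split=> //; first exact: filterI.
by move=> v vAB; split; apply: filterS vAB => x [].
Qed.

HB.instance Definition _ (T : Type) :=
  @isBaseTopological.Build (beta T) (set T) setT (@beta_basic T)
    (@beta_cover T) (@beta_join T).

Definition beta_unit (T : Type) (x : T) : beta T :=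
  Beta (principal_filter_ultra x).

Lemma fmap_ultra (S T : Type) (f : S -> T) (F : set_system S) :
  UltraFilter F -> UltraFilter (f @ F).
Proof.
move=> FU; split=> [|G GF sG]; first exact: fmap_proper_filter.
apply/seteqP; split=> // A GA.
have [//|FA] := in_ultra_setVsetC (f @^-1` A) FU.
have /sG GnA : (f @ F) (~` A) by [].
by have /filter_ex [? []] : G (A `&` ~` A) by exact: filterI.
Qed.

(** The continuous extension of a map of discrete sets. *)
Definition beta_map (S T : Type) (f : S -> T) (w : beta S) : beta T :=
  Beta (fmap_ultra f (beta_ultra w)).

Lemma beta_eqP (T : Type) (v w : beta T) :
  beta_sets v `<=` beta_sets w -> v = w.
Proof.
case: v w => [v vU] [w wU] /= vw.
have e : w = v by exact: max_filter vw.
by move: wU; rewrite e => wU; congr Beta; exact: Prop_irrelevance.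
Qed.

Lemma beta_basic_open (T : Type) (A : set T) : open (beta_basic A).
Proof.
exists [set A]; first by move=> B _.
by rewrite bigcup_set1.
Qed.

Lemma beta_nbhsP (T : Type) (w : beta T) (B : set (beta T)) :
  nbhs w B <-> exists2 A, beta_sets w A & beta_basic A `<=` B.
Proof.
split=> [|[A wA AB]]; last first.
  by rewrite nbhsE; exists (beta_basic A) => //; split=> //; exact: beta_basic_open.
rewrite nbhsE => -[_ [[D _ <-] [A DA wA]] sB]; exists A => //.
by move=> v vA; apply: sB; exists A.
Qed.

Lemma beta_unit_inj (T : Type) : injective (@beta_unit T).
Proof.
move=> x y xy.
have : beta_sets (beta_unit x) [set x] by exact/principal_filterP.
by rewrite xy => /principal_filterP.
Qed.

Lemma beta_unit_dense (T : Type) : closure (range (@beta_unit T)) = setT.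
Proof.
apply/seteqP; split=> // w _ B /beta_nbhsP[A /filter_ex[x Ax] sB].
by exists (beta_unit x); split; [exists x|apply: sB; exact/principal_filterP].
Qed.

Lemma beta_hausdorff (T : Type) : hausdorff_space (beta T).
Proof.
move=> v w vw; apply: beta_eqP => A vA.
have [//|wA] := in_ultra_setVsetC A (beta_ultra w).
have vn : nbhs v (beta_basic A) by apply/beta_nbhsP; exists A.
have wn : nbhs w (beta_basic (~` A)) by apply/beta_nbhsP; exists (~` A).
have [u [uA unA]] := vw _ _ vn wn.
by have /filter_ex [? []] : beta_sets u (A `&` ~` A) by exact: filterI.
Qed.

Lemma beta_compact (T : Type) : compact [set: beta T].
Proof.
rewrite compact_ultra => F FU _.
pose G := [set A : set T | F (beta_basic A)].
have GU : UltraFilter G.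
  split=> [|H HF sH].
    apply: Build_ProperFilter_ex.
      by move=> A /(@filter_ex _ F _)[w /(@filter_ex _ _ _)].
    split.
    - by apply: filterS (@filterT _ F _) => w _; exact: filterT.
    - move=> A B GA GB; apply: filterS (@filterI _ F _ _ _ GA GB).
      by move=> w [wA wB]; exact: filterI.
    - by move=> A B AB; apply: (@filterS _ F) => w; exact: filterS.
  apply/seteqP; split=> // A HA.
  have [//|FA] := in_ultra_setVsetC (beta_basic A) FU.
  have /sH HnA : G (~` A).
    apply: filterS FA => w nwA.
    by have [/nwA|] := in_ultra_setVsetC A (beta_ultra w).
  by have /filter_ex [? []] : H (A `&` ~` A) by exact: filterI.
exists (Beta GU); split=> // B /beta_nbhsP[A GA sB].
exact: filterS sB GA.
Qed.

Lemma beta_map_unit (S T : Type) (f : S -> T) (x : S) :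
  beta_map f (beta_unit x) = beta_unit (f x).
Proof.
apply: beta_eqP => A /principal_filterP fxA.
exact/principal_filterP.
Qed.

Lemma beta_map_continuous (S T : Type) (f : S -> T) :
  continuous (beta_map f).
Proof.
move=> w B /beta_nbhsP[A fwA sB].
by apply/beta_nbhsP; exists (f @^-1` A) => // v vA; exact: sB.
Qed.

Lemma beta_universal (T : Type) (K : topologicalType) (f : T -> K) :
  compact [set: K] -> hausdorff_space K ->
  exists! g : beta T -> K,
    continuous g /\ forall x, g (beta_unit x) = f x.
Proof.
move=> cK hK.
have ex : forall w : beta T, exists y : K, f @ beta_sets w --> y.
  move=> w; have FU := fmap_ultra f (beta_ultra w).
  move: cK; rewrite compact_ultra => /(_ _ FU filterT)[y [_ ?]].
  by exists y.
have [g gP] := boolp.choice ex.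
have gu x : g (beta_unit x) = f x.
  apply: hK => A B nA nB.
  have /principal_filterP fA := gP (beta_unit x) _ nA.
  by exists (f x); split=> //; exact: nbhs_singleton.
exists g; split; first split=> //.
  move=> w B nB.
  have [C nC CB] := compact_regular (x := g w) hK cK filterT nB.
  apply/beta_nbhsP; exists (f @^-1` C); first exact: gP.
  move=> v vC; apply: CB => D nD.
  have /filter_ex[x [Cx Dx]] : beta_sets v (f @^-1` C `&` f @^-1` D).
    by apply: filterI => //; exact: gP.
  by exists (f x).
move=> h [hc hu]; apply/funext => w; apply: hK => A B nA nB.
have /beta_nbhsP[C wC hB] := hc w _ nB.
have /filter_ex[x [Cx Ax]] : beta_sets w (C `&` f @^-1` A).
  by apply: filterI => //; exact: gP.
exists (f x); split=> //; rewrite -hu; apply: hB; exact/principal_filterP.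
Qed.

(** * Coarse geometry *)

Section coarse.
Context {R : realType} (X : metricType R).

Definition bounded_geometry : Prop :=
  forall r : R, 0 < r -> exists n : nat, forall x : X, (ball x r #<= `I_n)%card.

(* Not to be confused with the library's [entourage] of a uniform space. *)
Definition coarse_entourage (E : set (X * X)) : Prop :=
  has_ubound [set mdist p.1 p.2 | p in E].

Definition controlled (r : R) : set (X * X) :=
  [set p | mdist p.1 p.2 <= r].

Definition supp (alpha : X * X -> nat) : set (X * X) :=
  [set p | alpha p <> 0%N].

Definition rank_function (alpha : X * X -> nat) : Prop :=
  coarse_entourage (supp alpha).

Definition chi (E : set (X * X)) (p : X * X) : nat := p \in E.

(* The two sums below have finitely many non-zero terms when [X] has bounded
   geometry and [E] is an entourage (lemma [finite_entourage_section]); the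
   library's sum over an infinite set is 0 otherwise. *)
Definition entourage_mull (E : set (X * X)) (alpha : X * X -> nat) :
    X * X -> nat :=
  fun p => \big[addn/0%N]_(z \in [set: X]) (chi E (p.1, z) * alpha (z, p.2))%N.

Definition entourage_mulr (alpha : X * X -> nat) (E : set (X * X)) :
    X * X -> nat :=
  fun p => \big[addn/0%N]_(z \in [set: X]) (alpha (p.1, z) * chi E (z, p.2))%N.

Definition rank_transpose (alpha : X * X -> nat) : X * X -> nat :=
  fun p => alpha (p.2, p.1).

Record rank_distribution (RD : set (X * X -> nat)) : Prop := {
  rd_rank : forall alpha, RD alpha -> rank_function alpha ;
  rd_add : forall alpha alpha', RD alpha -> RD alpha' ->
    RD (fun p => (alpha p + alpha' p)%N) ;
  rd_transpose : forall alpha, RD alpha -> RD (rank_transpose alpha) ;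
  rd_mull : forall E alpha, coarse_entourage E -> RD alpha ->
    RD (entourage_mull E alpha) ;
  rd_mulr : forall E alpha, coarse_entourage E -> RD alpha ->
    RD (entourage_mulr alpha E) ;
  rd_finite : forall alpha, rank_function alpha -> finite_set (supp alpha) ->
    RD alpha ;
  rd_le : forall alpha alpha', rank_function alpha -> RD alpha' ->
    (forall p, (alpha p <= alpha' p)%N) -> RD alpha }.

Definition coarse_groupoid : set (beta (X * X)) :=
  \bigcup_(r in [set r : R | 0 <= r]) closure (@beta_unit (X * X) @` controlled r).

Definition range_map : beta (X * X) -> beta X := beta_map fst.
Definition source_map : beta (X * X) -> beta X := beta_map snd.

Definition invariant_set (U : set (beta X)) : Prop :=
  forall g, coarse_groupoid g -> U (source_map g) -> U (range_map g).

(* The closure in [beta X] of the projection of the support to the first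
   coordinate. *)
Definition closed_range (alpha : X * X -> nat) : set (beta X) :=
  closure (@beta_unit X @` (fst @` supp alpha)).

Definition rank_support (RD : set (X * X -> nat)) : set (beta X) :=
  \bigcup_(alpha in RD) closed_range alpha.

Definition Rmax (U : set (beta X)) : set (X * X -> nat) :=
  [set alpha | rank_function alpha /\ closed_range alpha `<=` U].

Definition Rmin (U : set (beta X)) : set (X * X -> nat) :=
  [set alpha | [/\ rank_function alpha, closed_range alpha `<=` U &
                   exists n : nat, forall p, (alpha p <= n)%N]].

Lemma finite_entourage_section (E : set (X * X)) (x : X) :
  bounded_geometry -> coarse_entourage E ->
  finite_set [set z | E (x, z)] /\ finite_set [set z | E (z, x)].
Proof.
move=> bg [M EM].
have r0 : 0 < `|M| + 1 :> R by rewrite ltr_wpDl.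
have [n /(_ x) xn] := bg _ r0.
have fb : finite_set (ball x (`|M| + 1)).
  by apply: card_le_finite xn _; exact: finite_II.
have le p : E p -> mdist p.1 p.2 < `|M| + 1.
  move=> Ep; apply: (@le_lt_trans _ _ M); first by apply: EM; exists p.
  by rewrite (le_lt_trans (ler_norm M))// ltrDl.
by split; apply: sub_finite_set fb => z /le /=; rewrite ballEmdist //= metric_sym.
Qed.

End coarse.

(* Main.v *)
Require Import Defs.
From mathcomp Require Import all_boot all_order all_algebra finmap.
From mathcomp Require Import all_classical all_reals topology.

Import Order.TTheory GRing.Theory Num.Theory.

Local Open Scope classical_set_scope.
Local Open Scope ring_scope.

(** In [beta X] the closure of a set [A] of points is the clopen set
    [beta_basic A] of the ultrafilters containing [A], so membership of a rank
    function in [Rmax U] says that [beta_basic] of the first projection of its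
    support lies in [U].  The subsets [A] of [X] with [beta_basic A] inside [U]
    form an ideal, and invariance makes this ideal stable under entourages
    ([invariant_thickening]): if every point of [A] is [E]-related to a point of
    [B] and [beta_basic B] is inside [U], then an ultrafilter [w] on [A] lifts
    to an ultrafilter [g] containing [E] with range [w] and source on [B]; as
    [g] is in the coarse groupoid and its source is in [U], so is [w].

    Transposition and multiplication by an entourage only move the first
    projection of the support along an entourage, hence they preserve
    [Rmax U].  For the rank functions with finite support, a finite set has no
    other ultrafilters than its points, and every point of [X] is in [U]: some
    point is, by density, and any two points of [X] are at finite distance.
    For [Rmin U] boundedness must be preserved too; bounded geometry bounds
    uniformly the number of terms in the sums defining the products.

    Finally [U], being open, is the union of the [beta_basic A] it contains,
    and [A] is the first projection of the support of the indicator function of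
    the diagonal of [A], which takes only the values 0 and 1. *)

(** * Ultrafilters *)

Lemma closure_beta_unit (T : Type) (A : set T) :
  closure (@beta_unit T @` A) = beta_basic A.
Proof.
apply/seteqP; split=> w.
  move=> clw; have [//|wA] := in_ultra_setVsetC A (beta_ultra w).
  have /clw[_ [[x Ax <-] /principal_filterP]] : nbhs w (beta_basic (~` A)).
    by apply/beta_nbhsP; exists (~` A).
  by [].
move=> wA B /beta_nbhsP[C wC sB].
have /filter_ex[x [Ax Cx]] : beta_sets w (A `&` C) by exact: filterI.
exists (beta_unit x); split; first by exists x.
by apply: sB; exact/principal_filterP.
Qed.

(** Finite sets are closed in the Hausdorff space [beta T], so an ultrafilter
    containing a finite set is one of its points. *)
Lemma beta_basic_finite {T : Type} {A : set T} : finite_set A ->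
  beta_basic A = @beta_unit T @` A.
Proof.
move=> finA; rewrite -closure_beta_unit; apply/esym/closure_id.
have /accessible_finite_set_closed := hausdorff_accessible (@beta_hausdorff T).
by apply; exact: finite_image.
Qed.

Lemma beta_basic_mono {T : Type} {A B : set T} :
  A `<=` B -> beta_basic A `<=` beta_basic B.
Proof. by move=> AB w; exact: filterS. Qed.

Lemma beta_basicU {T : Type} (A B : set T) :
  beta_basic (A `|` B) = beta_basic A `|` beta_basic B.
Proof.
apply/seteqP; split=> w; last first.
  by move=> []; apply: beta_basic_mono; [exact: subsetUl|exact: subsetUr].
move=> wAB; have [?|wA] := in_ultra_setVsetC A (beta_ultra w); [by left|right].
by apply: filterS (filterI wAB wA) => x [[]].
Qed.

(** The sets [D `&` f @^-1` A] for [A] in [w] are non-empty because [A] meets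
    [f @` D]; any ultrafilter refining the filter they generate is a lift. *)
Lemma beta_map_lift {S T : Type} {f : S -> T} {D : set S} {w : beta T} :
  beta_sets w (f @` D) -> exists2 g, beta_sets g D & beta_map f g = w.
Proof.
move=> wfD; pose F := filter_from (beta_sets w) (fun A => D `&` f @^-1` A).
have FF : ProperFilter F.
  apply: filter_from_proper.
    apply: filter_from_filter; first by exists setT; exact: filterT.
    move=> A B wA wB; exists (A `&` B); first exact: filterI.
    by move=> x [Dx [Ax Bx]].
  move=> A wA; have /filter_ex[y [Ay [x Dx fxy]]] : beta_sets w (A `&` f @` D).
    exact: filterI.
  by exists x; split=> //=; rewrite fxy.
have [G [GU sFG]] := ultraFilterLemma FF; exists (Beta GU) => /=.
  by apply: sFG; exists setT; [exact: filterT|move=> x []].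
apply/esym/beta_eqP => A wA; apply: sFG.
by exists A => // x [].
Qed.

(** * Entourages and rank functions *)

Section rank_functions.
Context {R : realType} {X : metricType R}.
Implicit Types (E : set (X * X)) (alpha : X * X -> nat).

(** A strict and positive bound is what the open balls in bounded geometry and
    the sets [controlled r] of the coarse groupoid ask for. *)
Lemma coarse_entourageP E : coarse_entourage E <->
  exists2 r : R, 0 < r & forall x y, E (x, y) -> mdist x y < r.
Proof.
split=> [[M EM]|[r r0 Er]].
  exists (`|M| + 1) => [|x y Exy]; first by rewrite ltr_wpDl.
  rewrite ltr_pwDr// (le_trans _ (ler_norm M))//.
  by apply: EM; exists (x, y).
by exists r => _ [[x y] Exy <-] /=; exact/ltW/Er.
Qed.

Lemma coarse_entourageS {E1 E2} :
  E1 `<=` E2 -> coarse_entourage E2 -> coarse_entourage E1.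
Proof.
move=> E12 /coarse_entourageP[r r0 Er]; apply/coarse_entourageP.
by exists r => // x y /E12 /Er.
Qed.

Lemma coarse_entourageU {E1 E2} : coarse_entourage E1 -> coarse_entourage E2 ->
  coarse_entourage (E1 `|` E2).
Proof.
move=> /coarse_entourageP[r r0 Er] /coarse_entourageP[s s0 Es].
apply/coarse_entourageP; exists (r + s) => [|x y]; first exact: addr_gt0.
by move=> [/Er xy|/Es xy]; apply: (lt_trans xy); rewrite (ltrDl, ltrDr).
Qed.

Lemma coarse_entourage_inv {E} :
  coarse_entourage E -> coarse_entourage (E^-1)%relation.
Proof.
move=> /coarse_entourageP[r r0 Er]; apply/coarse_entourageP.
by exists r => // x y /Er; rewrite metric_sym.
Qed.

Lemma coarse_entourage_comp {E1 E2} :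
  coarse_entourage E1 -> coarse_entourage E2 ->
  coarse_entourage [set p | exists z, E1 (p.1, z) /\ E2 (z, p.2)].
Proof.
move=> /coarse_entourageP[r r0 Er] /coarse_entourageP[s s0 Es].
apply/coarse_entourageP; exists (r + s) => [|x y [z /= [/Er xz /Es zy]]].
  exact: addr_gt0.
by apply: (le_lt_trans (metric_triangle x z y)); exact: ltrD.
Qed.

Lemma coarse_entourage_groupoid {E} :
  coarse_entourage E -> beta_basic E `<=` @coarse_groupoid R X.
Proof.
move=> /coarse_entourageP[r r0 Er] g gE; exists r; first exact: ltW.
rewrite closure_beta_unit; apply: beta_basic_mono gE => -[x y] /Er.
exact: ltW.
Qed.

Lemma entourage_section_card {E} : bounded_geometry X -> coarse_entourage E ->
  exists n, forall x, ([set z | E (x, z)] #<= `I_n)%card.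
Proof.
move=> bg /coarse_entourageP[r r0 Er]; have [n xn] := bg _ r0.
exists n => x; apply: card_le_trans (xn x); apply: subset_card_le => z /Er.
by rewrite ballEmdist.
Qed.

Lemma supp_add alpha alpha' :
  supp (fun p => (alpha p + alpha' p)%N) = supp alpha `|` supp alpha'.
Proof.
apply/seteqP; split=> p; rewrite /supp /=.
  by case: (alpha p) => [|n]; [right|left].
by move=> [/eqP|/eqP] h; apply/eqP; rewrite addn_eq0 negb_and h ?orbT.
Qed.

Lemma supp_le alpha alpha' :
  (forall p, (alpha p <= alpha' p)%N) -> supp alpha `<=` supp alpha'.
Proof.
by move=> le p /eqP; rewrite /supp /= => + p0; rewrite -leqn0 -p0 le.
Qed.

Lemma supp_mull E alpha : supp (entourage_mull E alpha) `<=`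
  [set p | exists z, E (p.1, z) /\ supp alpha (z, p.2)].
Proof.
move=> p; rewrite {1}/supp /=; apply: contra_notP => nz.
apply: fsbig1 => z _; rewrite /chi.
have [/set_mem Ez|//] := boolP (_ \in E); rewrite mul1n.
by apply: contra_notP nz => az; exists z.
Qed.

(** Reduces right products to left ones in every closure property below. *)
Lemma entourage_mulrE E alpha : entourage_mulr alpha E =
  rank_transpose (entourage_mull E^-1%relation (rank_transpose alpha)).
Proof.
apply/funext => p; rewrite /entourage_mulr /rank_transpose /entourage_mull /=.
by apply: eq_fsbigr => z _; rewrite mulnC.
Qed.

(** An entry of the product is a sum of entries of [alpha] over a section of [E],
    and the sections of [E] have uniformly bounded cardinality. *)
Lemma entourage_mull_bounded {E alpha k} :
  bounded_geometry X -> coarse_entourage E ->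
  (forall p, (alpha p <= k)%N) ->
  exists m, forall p, (entourage_mull E alpha p <= m)%N.
Proof.
move=> bg entE alphak; have [n En] := entourage_section_card bg entE.
exists (n * k)%N => p.
have finE := (finite_entourage_section p.1 bg entE).1.
(* The support of the summand lies in the section of [E] over the first point. *)
rewrite /entourage_mull -(@fsbig_widen _ _ _ _ [set z | E (p.1, z)])//;
    last by move=> z [_ nEz] /=; rewrite /chi memNset.
rewrite fsbig_finite//=.
apply: (@leq_trans (\sum_(z <- fset_set [set z | E (p.1, z)]) k)%N).
  apply: leq_sum => z _; rewrite -[leqRHS]mul1n leq_mul//.
  by rewrite /chi leq_b1.
rewrite big_const_seq iter_addn addn0 mulnC count_predT leq_mul2r.
by apply/orP; right; exact: geq_card_fset_set (En p.1).
Qed.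

Lemma finite_supp_bounded {alpha} : finite_set (supp alpha) ->
  exists n, forall p, (alpha p <= n)%N.
Proof.
move=> fin; exists (\max_(p <- fset_set (supp alpha)) alpha p)%N => p.
have [->//|/eqP ap] := eqVneq (alpha p) 0%N.
apply: leq_bigmax_seq => //.
by rewrite in_fset_set// inE.
Qed.

End rank_functions.

(** * Invariant open sets *)

Section invariant_open.
Context {R : realType} {X : metricType R}.
Variable U : set (beta X).
Hypotheses (bgX : bounded_geometry X) (U_invariant : invariant_set U).
Hypotheses (U_nonempty : U !=set0) (U_open : open U).
Implicit Types (E : set (X * X)) (alpha : X * X -> nat) (A B : set X).

(** An ultrafilter containing [A] is the range of one containing
    [E `&` snd @^-1` B], whose source contains [B]. *)
Lemma invariant_thickening {E A B} : coarse_entourage E ->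
  (forall x, A x -> exists2 y, E (x, y) & B y) ->
  beta_basic B `<=` U -> beta_basic A `<=` U.
Proof.
move=> entE AEB BU w wA; pose D := E `&` snd @^-1` B.
have wD : beta_sets w (fst @` D).
  by apply: filterS wA => x /AEB[y Exy By]; exists (x, y).
have [g gD <-] := beta_map_lift wD.
apply: U_invariant.
  apply: (coarse_entourage_groupoid entE).
  by apply: filterS gD => p [].
by apply: BU; apply: filterS gD => p [].
Qed.

Lemma open_basic {w} :
  U w -> exists2 A, beta_sets w A & beta_basic A `<=` U.
Proof. by move=> Uw; apply/beta_nbhsP; exact: open_nbhs_nbhs. Qed.

(** The singleton of the pair [(x, y)] is an entourage, so one point [y] of [X] in
    [U] brings in all the others. *)
Lemma invariant_open_unit x : U (beta_unit x).
Proof.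
have [w /open_basic[A /filter_ex[y Ay] AU]] := U_nonempty.
have unit_in (z : X) : beta_basic [set z] (beta_unit z).
  exact/principal_filterP.
suff : beta_basic [set x] `<=` U by exact.
apply: (@invariant_thickening [set (x, y)] _ [set y]).
- by apply/coarse_entourageP; exists (mdist x y + 1) => [|_ _ [-> ->]];
    rewrite ?ltrDl// ltr_wpDl// mdist_ge0.
- by move=> _ ->; exists y.
- by apply: subset_trans AU; apply: beta_basic_mono => _ ->.
Qed.

Lemma RmaxP alpha : Rmax U alpha <->
  rank_function alpha /\ beta_basic (fst @` supp alpha) `<=` U.
Proof. by rewrite /Rmax /= /closed_range closure_beta_unit. Qed.

Lemma RminP alpha :
  Rmin U alpha <-> Rmax U alpha /\ exists n, forall p, (alpha p <= n)%N.
Proof. by split=> [[? ? ?]|[[? ?] ?]]. Qed.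

Lemma Rmax_add alpha alpha' : Rmax U alpha -> Rmax U alpha' ->
  Rmax U (fun p => (alpha p + alpha' p)%N).
Proof.
move=> /RmaxP[rk aU] /RmaxP[rk' aU']; apply/RmaxP.
rewrite /rank_function supp_add image_setU beta_basicU subUset.
by split=> //; exact: coarse_entourageU.
Qed.

Lemma Rmax_transpose alpha : Rmax U alpha -> Rmax U (rank_transpose alpha).
Proof.
move=> /RmaxP[rk aU]; have rkt := coarse_entourage_inv rk.
apply/RmaxP; split=> //; apply: invariant_thickening rkt _ aU.
by move=> _ [[x y] /= xy <-]; exists y => //; exists (y, x).
Qed.

Lemma Rmax_mull E alpha : coarse_entourage E -> Rmax U alpha ->
  Rmax U (entourage_mull E alpha).
Proof.
move=> entE /RmaxP[rk aU]; apply/RmaxP; split.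
  exact: coarse_entourageS (supp_mull _ _) (coarse_entourage_comp entE rk).
apply: invariant_thickening entE _ aU => _ [[x y] /supp_mull[z /= [xz zy]] <-].
by exists z => //; exists (z, y).
Qed.

Lemma Rmax_mulr E alpha : coarse_entourage E -> Rmax U alpha ->
  Rmax U (entourage_mulr alpha E).
Proof.
move=> entE Ra; rewrite entourage_mulrE; apply/Rmax_transpose/Rmax_mull.
  exact: coarse_entourage_inv.
exact: Rmax_transpose.
Qed.

Lemma Rmax_finite alpha : rank_function alpha -> finite_set (supp alpha) ->
  Rmax U alpha.
Proof.
move=> rk fin; apply/RmaxP; split=> // w.
rewrite (beta_basic_finite (finite_image fst fin)) => -[x _ <-].
exact: invariant_open_unit.
Qed.

Lemma Rmax_le alpha alpha' : rank_function alpha -> Rmax U alpha' ->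
  (forall p, (alpha p <= alpha' p)%N) -> Rmax U alpha.
Proof.
move=> rk /RmaxP[_ aU] le; apply/RmaxP; split=> //.
apply: subset_trans aU; apply: beta_basic_mono.
by apply: image_subset; exact: supp_le.
Qed.

Lemma Rmax_rank_distribution : rank_distribution (Rmax U).
Proof.
split; [by move=> ? []|exact: Rmax_add|exact: Rmax_transpose|exact: Rmax_mull
  |exact: Rmax_mulr|exact: Rmax_finite|exact: Rmax_le].
Qed.

Lemma Rmin_rank_distribution : rank_distribution (Rmin U).
Proof.
split.
- by move=> ? [].
- move=> a b /RminP[Ra [k ak]] /RminP[Rb [l bl]]; apply/RminP.
  split; first exact: Rmax_add.
  by exists (k + l)%N => p; exact: leq_add.
- move=> a /RminP[Ra [k ak]]; apply/RminP; split; first exact: Rmax_transpose.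
  by exists k => p; exact: ak.
- move=> E a entE /RminP[Ra [k ak]]; apply/RminP; split; first exact: Rmax_mull.
  exact: entourage_mull_bounded ak.
- move=> E a entE /RminP[Ra [k ak]]; apply/RminP; split; first exact: Rmax_mulr.
  have atk p : (rank_transpose a p <= k)%N by exact: ak.
  have [m ma] := entourage_mull_bounded bgX (coarse_entourage_inv entE) atk.
  by exists m => p; rewrite entourage_mulrE; exact: ma.
- move=> a rk fin; apply/RminP; split; first exact: Rmax_finite.
  exact: finite_supp_bounded.
- move=> a b rk /RminP[Rb [k bk]] le; apply/RminP.
  split; first exact: Rmax_le Rb le.
  by exists k => p; exact: leq_trans (le p) (bk p).
Qed.

Lemma rank_support_Rmax_sub : rank_support (Rmax U) `<=` U.
Proof. by move=> w [a [_ aU] /aU]. Qed.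

Lemma rank_support_Rmin_sub : rank_support (Rmin U) `<=` rank_support (Rmax U).
Proof. by apply: bigcup_subset => a /RminP[]. Qed.

(** The witness is the indicator function of the diagonal of a set [A] with [w] in
    [beta_basic A] and [beta_basic A] inside [U]. *)
Lemma sub_rank_support_Rmin : U `<=` rank_support (Rmin U).
Proof.
move=> w /open_basic[A wA AU].
pose a : X * X -> nat := chi [set p | A p.1 /\ p.1 = p.2].
have suppa : supp a = [set p | A p.1 /\ p.1 = p.2].
  apply/seteqP; split=> p; rewrite /supp /a /chi /=.
    by have [/set_mem|//] := boolP (p \in _).
  by move=> Ap; rewrite mem_set.
have fsta : fst @` supp a = A.
  rewrite suppa; apply/seteqP; split=> [_ [[x y] [/= Ax _] <-]//|x Ax].
  by exists (x, x).
exists a; last by rewrite /closed_range closure_beta_unit fsta.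
apply/RminP; split; last by exists 1%N => p; exact: leq_b1.
apply/RmaxP; rewrite fsta; split=> //; rewrite /rank_function suppa.
by apply/coarse_entourageP; exists 1 => // x y [_ /= ->]; rewrite mdistxx.
Qed.

End invariant_open.

Theorem lemma4p6 (R : realType) (X : metricType R)
  (discreteX : forall A : set X, open A)
  (bgX : bounded_geometry X)
  (U : set (beta X))
  (U_nonempty : U !=set0) (U_open : open U) (U_invariant : invariant_set U) :
  [/\ rank_distribution (Rmin U), rank_distribution (Rmax U),
      rank_support (Rmax U) = U & rank_support (Rmin U) = U].
Proof.
have max_sub := rank_support_Rmax_sub U.
have min_sub := rank_support_Rmin_sub U.
have sub_min := sub_rank_support_Rmin U U_open.
split.
- exact: Rmin_rank_distribution.
- exact: Rmax_rank_distribution.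
- by apply/seteqP; split=> //; exact: subset_trans sub_min min_sub.
- by apply/seteqP; split=> //; exact: subset_trans min_sub max_sub.
Qed.
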